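(* One has $\rho_1=1$, while $\rho_m\in(1,2)$ for every $m\ge2$. Moreover, $2-\rho_m=\rho_m^{-m}$ for every $m\ge1$, and, as $m\to\infty$, $\rho_m\uparrow2$, $2-\rho_m\sim2^{-m}$, and $\log 2-\log\rho_m\sim2^{-m-1}$. For every $m\ge1$ there is a constant $c_m>0$, depending only on $m$, such that for every $n\ge1$: if the first $n$ layers $\omega_1,\dots,\omega_n$ are all $m$-favorable, then $N_n\ge c_m\rho_m^{n}$.
   Context: For an integer $m\ge1$, $A_m$ is the $m\times m$ matrix whose first row consists of ones, whose subdiagonal entries equal one, and all of whose other entries are zero; $\rho_m$ is its Perron root, i.e. its spectral radius. The notation $x_m\sim y_m$ means $x_m/y_m\to1$. Fix $0<\varepsilon<1$. For $a,b>0$ let $h(a,b):=ab/(a+b)$, and let $U_\varepsilon:=\{(a,b)\in(0,\infty)^2: |a-2|\le\varepsilon,\ |b-2|\le\varepsilon,\ h(a,b)\le1\}$. Let $\mu_\varepsilon$ be a probability measure supported on $U_\varepsilon$ and let the layers $(\omega_n)_{n\ge1}$ be i.i.d. with law $\mu_\varepsilon$. For $\omega=(a,b)\in U_\varepsilon$ put $c(\omega):=b/(a+b)$, $h(\omega):=ab/(a+b)$, $\eta(\omega):=1-h(\omega)$, and $T_\omega(x):=\max\{0,\min(ax,b(1-x))\}$, which maps $[0,1]$ into $[0,1]$. Set $F_n:=T_{\omega_n}\circ\cdots\circ T_{\omega_1}$ and let $N_n$ be the smallest number of subintervals partitioning $[0,1]$ on each of which $F_n$ is affine. Put $\delta_\varepsilon:=\frac12\inf_{\omega\in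 U_\varepsilon}\min\{c(\omega),1-c(\omega)\}=(2-\varepsilon)/8$, $K_\varepsilon:=2+\varepsilon$ and $r_i:=\delta_\varepsilon K_\varepsilon^{-i}$ for $i=0,\dots,m$. A layer $\omega$ is called $m$-favorable if $\eta(\omega)\le r_m$. *)

(* Defs.v *)
From HB Require Import structures.
From mathcomp Require Import all_boot all_order all_algebra.
From mathcomp Require Import complex.
From mathcomp Require Import all_classical all_reals all_analysis.

Set Implicit Arguments.
Unset Strict Implicit.
Unset Printing Implicit Defensive.

Import Order.TTheory GRing.Theory Num.Theory.
Import numFieldNormedType.Exports.

Local Open Scope classical_set_scope.
Local Open Scope ring_scope.

Definition Amx (R : realType) (m : nat) : 'M[R]_m :=
  \matrix_(i < m, j < m)
    if (i == 0%N :> nat) || (i == j.+1 :> nat) then 1 else 0.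

(* The eigenvalues are the complex ones; the norm of R[i] takes values in the
   real elements of R[i], hence the projection Re. *)
Definition spectral_radius (R : realType) (n : nat) (A : 'M[R]_n) : R :=
  sup [set complex.Re `|z| | z in
        [set z : R[i] | eigenvalue (map_mx (real_complex R) A) z]].

Definition rho (R : realType) (m : nat) : R := spectral_radius (Amx R m).

Section Layers.
Variable R : realType.
Implicit Types (eps : R) (w : R * R).

Definition hpar w : R := w.1 * w.2 / (w.1 + w.2).
Definition cpar w : R := w.2 / (w.1 + w.2).
Definition eta w : R := 1 - hpar w.

Definition Ueps eps : set (R * R) :=
  [set w | [/\ 0 < w.1, 0 < w.2, `|w.1 - 2| <= eps, `|w.2 - 2| <= eps
             & hpar w <= 1]].

Definition tent w (x : R) : R :=
  Num.max 0 (Num.min (w.1 * x) (w.2 * (1 - x))).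

(* Layers are indexed from 0: omega k is the (k+1)-st layer, so that
   Fcomp omega n composes the first n layers omega 0, ..., omega n.-1. *)
Fixpoint Fcomp (omega : nat -> R * R) (n : nat) : R -> R :=
  if n is k.+1 then tent (omega k) \o Fcomp omega k else id.

Definition affine_on (I : set R) (f : R -> R) : Prop :=
  exists p q : R, forall x, I x -> f x = p * x + q.

Definition affine_partition (f : R -> R) (k : nat) : Prop :=
  exists I : 'I_k -> set R,
    [/\ partition [set: 'I_k] I `[0, 1],
        forall i, is_interval (I i)
      & forall i, affine_on (I i) f].

(* The value is 0 when f has no finite affine partition. *)
Definition affine_pieces (f : R -> R) : nat :=
  xget 0%N [set k | affine_partition f k /\
                    forall j, affine_partition f j -> (k <= j)%N].

Definition delta eps : R :=
  2^-1 * inf [set Num.min (cpar w) (1 - cpar w) | w in Ueps eps].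

Definition Kpar eps : R := 2 + eps.

Definition rpar eps (i : nat) : R := delta eps * Kpar eps ^- i.

(* A layer is an element of Ueps; a random layer of law mu with mu (Ueps) = 1
   lies in Ueps only almost surely, hence the explicit membership. *)
Definition favorable eps (m : nat) w : Prop :=
  Ueps eps w /\ eta w <= rpar eps m.

End Layers.

Definition mutually_independent d d' (Omega : measurableType d)
    (T : measurableType d') (R : realType) (P : probability Omega R)
    (X : nat -> {RV P >-> T}) : Prop :=
  forall (s : seq nat) (B : nat -> set T),
    uniq s -> (forall i, measurable (B i)) ->
    P (\bigcap_(i in [set` s]) X i @^-1` B i) =
      (\prod_(i <- s) P (X i @^-1` B i))%E.

Definition iid_with_law d d' (Omega : measurableType d)
    (T : measurableType d') (R : realType) (P : probability Omega R)
    (X : nat -> {RV P >-> T}) (mu : probability T R) : Prop :=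
  mutually_independent X /\
  forall n (B : set T), measurable B -> distribution P (X n) B = mu B.

(* Main.v *)
(** An eigenvalue z of A_m satisfies z^m = 1 + z + ... + z^(m-1). On the
    positive axis the ratio of the two sides is increasing, so there is a
    unique positive root r, and the triangle inequality gives |z| <= r for
    every eigenvalue. Multiplying by r - 1 yields 2 - r = r^(-m), from which
    the asymptotics follow.

    The affine pieces are bounded below by the number of preimages of a single
    point, pulled back through the layers: for m-favorable layers a point y
    with r_i < y < 1 - r_m, i < m, has the two preimages y / a, at level
    i + 1, and 1 - y / b, at level 0. The transition matrix of the levels
    0, ..., m - 1 is that of A_m, and its Perron eigenvector with first entry 1
    has entries at most 1, so the constant c_m = 1 works. Fibers are finite, so
    no affine piece contains two points of the same fiber. *)
Require Import Defs.
From HB Require Import structures.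
From mathcomp Require Import all_boot all_order all_algebra.
From mathcomp Require Import complex.
From mathcomp Require Import all_classical all_reals all_analysis.
From mathcomp Require Import ring lra zify.

Set Implicit Arguments.
Unset Strict Implicit.
Unset Printing Implicit Defensive.

Import Order.TTheory GRing.Theory Num.Theory.
Import numFieldNormedType.Exports.

Local Open Scope classical_set_scope.
Local Open Scope ring_scope.

(** * The characteristic equation of [Amx] and its positive root *)

Section PerronRoot.
Variable R : realType.

(** Column by column, [v A = z v] is the recursion [v_(k+1) = z v_k - v_0], solved by
    [v_k = v_0 (z^k - (1 + ... + z^(k-1)))]; the last column demands that the next term vanish. *)
Lemma eigenvalue_Amx m (z : R[i]) :
  eigenvalue (map_mx (real_complex R) (Amx R m.+1)) z =
  (z ^+ m.+1 == \sum_(k < m.+1) z ^+ k).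
Proof.
set A := map_mx _ _.
have mulA (v : 'rV_m.+1) j : (v *m A) 0 j =
    v 0 0 + (if (j < m)%N then v 0 (inord j.+1) else 0).
  rewrite mxE (bigD1 ord0) //= !mxE eqxx rmorph1 mulr1; congr (_ + _).
  under eq_bigr => i i0 do
    rewrite !mxE (negbTE (i0 : (i : nat) != 0%N)) /= (fun_if (real_complex R)) rmorph1 rmorph0.
  case: ifPn => jm.
    rewrite (bigD1 (inord j.+1)) /=; last by rewrite -val_eqE /= inordK.
    rewrite inordK // eqxx mulr1 big1 ?addr0// => i /andP[_ ij].
    case: eqP => [ij'|]; last by rewrite mulr0.
    by case/eqP: ij; apply: val_inj; rewrite /= inordK.
  rewrite big1 // => i _; case: eqP => [ij'|]; last by rewrite mulr0.
  by move: (ltn_ord i); rewrite ij' ltnS (negbTE jm).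
apply/eigenvalueP/eqP => [[v vA v0]|zm].
(* Extending [v] by a zero entry at index [m.+1] puts the last column under the same recursion as
   the others. *)
- pose u k := if (k <= m)%N then v 0 (inord k) else 0.
  have uS k : (k <= m)%N -> u k.+1 = z * u k - u 0%N.
    move=> km; rewrite /u km /=.
    have := congr1 (fun w : 'rV_m.+1 => w 0 (inord k)) vA.
    rewrite mulA mxE inordK // => <-.
    by rewrite (_ : inord 0 = 0) ?[v 0 0 + _]addrC ?addrK //; apply: val_inj; rewrite /= inordK.
  have uE k : (k <= m.+1)%N -> u k = u 0%N * (z ^+ k - \sum_(i < k) z ^+ i).
    elim: k => [|k IH] km; first by rewrite big_ord0 expr0 subr0 mulr1.
    rewrite uS // IH 1?ltnW // big_ord_recl expr0.
    under [in RHS]eq_bigr do rewrite lift0 exprS.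
    by rewrite -mulr_sumr exprS; ring.
  have u0 : u 0%N != 0.
    apply: contra v0 => /eqP u0; apply/eqP/rowP => j; rewrite mxE.
    have := uE j (ltnW (ltn_ord j)); rewrite u0 mul0r => <-.
    by rewrite /u -ltnS ltn_ord inord_val.
  have := uE m.+1 (leqnn _); rewrite {1}/u ltnn => /esym/eqP.
  by rewrite mulf_eq0 (negbTE u0) subr_eq0 => /eqP.
- pose s k := z ^+ k - \sum_(i < k) z ^+ i.
  exists (\row_(j < m.+1) s j).
    apply/rowP => j; rewrite mulA !mxE.
    have sS : s j.+1 = z * s j - 1.
      rewrite /s big_ord_recl expr0.
      under eq_bigr do rewrite lift0 exprS.
      by rewrite -mulr_sumr exprS; ring.
    have -> : s 0%N = 1 by rewrite /s big_ord0 expr0 subr0.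
    case: ifPn => jm; first by rewrite inordK // sS; ring.
    have jE : j = m :> nat by apply/eqP; rewrite eqn_leq -ltnS ltn_ord leqNgt.
    have : s j.+1 = 0 by rewrite jE /s zm subrr.
    by rewrite sS addr0 => /subr0_eq.
  apply/negP => /eqP/rowP/(_ 0); rewrite !mxE /s big_ord0 expr0 subr0.
  by apply/eqP; exact: oner_neq0.
Qed.

(** After multiplication by [r^m], with [r^m] expanded on the right only, the sums compare termwise:
    [x^k r^m < x^m r^k] because [r^(m-k) < x^(m-k)]. *)
Lemma sum_expr_lt (m : nat) (r x : R) : (0 < m)%N -> 0 < r < x ->
  r ^+ m = \sum_(k < m) r ^+ k -> \sum_(k < m) x ^+ k < x ^+ m.
Proof.
move=> m0 /andP[r0 rx] rm.
have x0 : 0 < x by exact: lt_trans rx.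
rewrite -(ltr_pM2r (exprn_gt0 m r0)) {2}rm mulr_suml mulr_sumr.
apply: ltr_sum => [|k _]; first by apply/hasP; exists (Ordinal m0); rewrite ?mem_index_enum.
have expB (u : R) : u ^+ m = u ^+ k * u ^+ (m - k) by rewrite -exprD subnKC // ltnW.
rewrite !expB [ltRHS]mulrAC mulrA.
rewrite ltr_pM2l ?mulr_gt0 ?exprn_gt0 //.
by rewrite ltrXn2r ?ltW // ?ltW // subn_eq0 -ltnNge ltn_ord.
Qed.

Lemma rho_spec (m : nat) : (0 < m)%N ->
  1 <= rho R m < 2 /\ rho R m ^+ m = \sum_(k < m) rho R m ^+ k.
Proof.
case: m => // m _.
pose p : {poly R} := 'X^(m.+1) - \sum_(k < m.+1) 'X^k.
have pE x : p.[x] = x ^+ m.+1 - \sum_(k < m.+1) x ^+ k.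
  rewrite /p hornerD hornerN horner_sum hornerXn.
  by under eq_bigr do rewrite hornerXn.
(* The geometric sum gives [1 + 2 + ... + 2^m = 2^(m+1) - 1]. As [p.[1] <= 0], a root lies in
   [[1, 2]], and it is not 2. *)
have p2 : p.[2] = 1.
  have := subrX1 (2 : R) m.+1; rewrite pE; set S := \sum_(_ < _) _.
  lra.
have [r /andP[r1 r2] /eqP] : exists2 x, 1 <= x <= 2 & root p x.
  apply: poly_ivt; first by lra.
  rewrite p2 ler01 andbT pE expr1n subr_le0.
  under eq_bigr do rewrite expr1n.
  by rewrite sumr_const card_ord -[X in X <= _]/(1%:R) ler_nat.
rewrite pE => /subr0_eq rE.
have rlt2 : r < 2.
  rewrite lt_neqAle r2 andbT; apply/eqP => r2'.
  by have := p2; rewrite pE -r2' rE subrr => /esym/eqP; rewrite oner_eq0.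
have r0 : 0 < r by lra.
suff -> : rho R m.+1 = r by rewrite r1 rlt2.
rewrite /rho /spectral_radius; set S := [set _ | _ in _].
have Sub : ubound S r.
  move=> _ [z /= + <-]; rewrite eigenvalue_Amx => /eqP zm.
  have nz : `|z| = (complex.Re `|z|)%:C%C by rewrite normc_def.
  rewrite leNgt; apply/negP => rz.
  have := sum_expr_lt (ltn0Sn m) (introT andP (conj r0 rz)) rE.
  apply/negP; rewrite -leNgt -lecR rmorphXn rmorph_sum /=.
  under eq_bigr do rewrite rmorphXn /=.
  rewrite -nz -normrX zm.
  apply: le_trans (ler_norm_sum _ _ _) _.
  by rewrite le_eqVlt; apply/orP; left; apply/eqP/eq_bigr => i _; rewrite normrX.
have Sr : S r.
  exists (r%:C%C); last by rewrite normc_def /= expr0n addr0 sqrtr_sqr gtr0_norm.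
  rewrite /= eigenvalue_Amx -rmorphXn rE rmorph_sum /=.
  by apply/eqP; apply: eq_bigr => i _; rewrite rmorphXn.
apply/eqP; rewrite eq_le ge_sup //=; last by exists r.
by apply: ub_le_sup => //; exists r.
Qed.

Lemma rho_ge1 m : (0 < m)%N -> 1 <= rho R m.
Proof. by move=> /rho_spec[/andP[]]. Qed.

Lemma rho_lt2 m : (0 < m)%N -> rho R m < 2.
Proof. by move=> /rho_spec[/andP[]]. Qed.

Lemma rho1 : rho R 1 = 1.
Proof. by have [_] := rho_spec (ltn0Sn 0); rewrite big_ord_recl big_ord0 expr1 expr0 addr0. Qed.

Lemma rho_sub2 m : (0 < m)%N -> 2 - rho R m = rho R m ^- m.
Proof.
move=> m0; have [/andP[r1 _] rE] := rho_spec m0.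
have rm : rho R m ^+ m != 0 by rewrite expf_neq0 // gt_eqF //; lra.
apply: (mulIf rm); rewrite mulVf //.
have := subrX1 (rho R m) m; rewrite -rE; lra.
Qed.

(** Multiplying the equation of [rho R m] by [rho R m] leaves it short of the next equation by the
    term 1, whereas at or beyond [rho R m.+1] the power is at least the sum. *)
Lemma rho_ltS m : (0 < m)%N -> rho R m < rho R m.+1.
Proof.
move=> m0; have [/andP[r1 _] rE] := rho_spec m0.
have [/andP[s1 _] sE] := rho_spec (ltn0Sn m).
have rS : rho R m ^+ m.+1 < \sum_(k < m.+1) rho R m ^+ k.
  rewrite big_ord_recl expr0 exprS rE mulr_sumr.
  under [in ltRHS]eq_bigr do rewrite lift0 exprS.
  lra.
rewrite ltNge le_eqVlt; apply/negP => /orP[/eqP sr|sr].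
  by move: rS; rewrite -sr sE ltxx.
have := sum_expr_lt (ltn0Sn m) (introT andP (conj (lt_le_trans ltr01 s1) sr)) sE.
by move=> /(lt_trans rS); rewrite ltxx.
Qed.

Lemma rho_lt m m' : (0 < m)%N -> (m < m')%N -> rho R m < rho R m'.
Proof.
move=> m0; elim: m' => // m' IH; rewrite ltnS leq_eqVlt => /orP[/eqP <-|mm'].
  exact: rho_ltS.
by apply: lt_trans (IH mm') (rho_ltS _); apply: leq_trans mm'.
Qed.

Lemma rho_gt1 m : (1 < m)%N -> 1 < rho R m.
Proof. by move=> m1; rewrite -rho1 rho_lt. Qed.

End PerronRoot.

(** * Asymptotics of [rho R m] and of its logarithm *)

Section PerronAsymptotics.
Variable R : realType.

Lemma bernoulli_ineq (x : R) n : -1 <= x -> 1 + n%:R * x <= (1 + x) ^+ n.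
Proof.
move=> x1; elim: n => [|n IH]; first by rewrite mul0r addr0 expr0.
rewrite exprS -natr1.
have n0 : 0 <= n%:R :> R by [].
have : (1 + x) * (1 + n%:R * x) <= (1 + x) * (1 + x) ^+ n.
  by rewrite ler_wpM2l //; lra.
by apply: le_trans; nra.
Qed.

(** [rho R 2] is the golden ratio. The bound is a square so that Bernoulli, applied to [(5/4)^m],
    yields quadratic growth of [rho R 2 ^+ m]. *)
Lemma rho2_ge : (5 / 4) ^+ 2 <= rho R 2.
Proof.
have := rho_ge1 R (isT : (0 < 2)%N).
have [_] := rho_spec R (isT : (0 < 2)%N).
rewrite !big_ord_recl big_ord0 /= expr0 addr0 expr1; nra.
Qed.

(** By monotonicity and Bernoulli, [rho_m^m >= (5/4)^(2m) >= ((m+1)/4)^2]; hence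
    [m rho_m^(-m) <= 16 m / (m+1)^2], and [harmonic m] is [1/(m+1)]. *)
Lemma rho_sub2_le m : (2 <= m)%N -> m%:R * (2 - rho R m) <= 16 * harmonic m.
Proof.
move=> m2; have m0 : (0 < m)%N by exact: ltnW.
have rm : rho R 2 <= rho R m.
  by move: m2; rewrite leq_eqVlt => /orP[/eqP <-|/rho_lt/ltW ->].
have : (m.+1%:R / 4) ^+ 2 <= rho R m ^+ m.
  apply: (@le_trans _ _ (((5 / 4) ^+ 2) ^+ m)); last first.
    have le2 := le_trans rho2_ge rm.
    by rewrite lerXn2r ?nnegrE // (le_trans _ le2) // exprn_ge0.
  rewrite exprAC lerXn2r ?nnegrE ?exprn_ge0 ?divr_ge0 //.
  have := @bernoulli_ineq (1 / 4) m.
  rewrite (_ : 1 + 1 / 4 = 5 / 4); last by field.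
  have n0 : 0 <= m%:R :> R by [].
  move=> /(_ ltac:(lra)); apply: le_trans; rewrite -natr1; lra.
rewrite rho_sub2 //= => h.
have r0 : 0 < rho R m ^+ m by rewrite exprn_gt0 // (lt_le_trans ltr01) ?rho_ge1.
rewrite ler_pdivrMr // mulrAC ler_pdivlMr //.
have n0 : 0 <= m%:R :> R by [].
move: h; rewrite -natr1; nra.
Qed.

Lemma cvg_mul_rho_sub2 : m%:R * (2 - rho R m) @[m --> \oo] --> (0 : R).
Proof.
apply: (@squeeze_cvgr _ _ _ _ (cst 0) (fun m => 16 * harmonic m)).
- near=> m; have m2 : (2 <= m)%N by near: m; exact: nbhs_infty_ge.
  apply/andP; split; last exact: rho_sub2_le.
  by rewrite mulr_ge0 // subr_ge0 ltW // rho_lt2 // ltnW.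
- exact: cvg_cst.
- by rewrite -[X in _ --> X](mulr0 (16 : R)); apply: cvgMr; exact: cvg_harmonic.
Unshelve. all: by end_near. Qed.

Lemma cvg_rho : rho R m @[m --> \oo] --> (2 : R).
Proof.
apply: (@squeeze_cvgr _ _ _ _ (fun m => 2 - m%:R * (2 - rho R m)) (cst 2)).
- near=> m; have m1 : (1 <= m)%N by near: m; exact: nbhs_infty_ge.
  have r2 := rho_lt2 R m1.
  apply/andP; split; last exact: ltW.
  by rewrite lerBlDr -lerBlDl ler_peMl ?ler1n // subr_ge0 ltW.
- rewrite -[X in _ --> X](subr0 (2 : R)); apply: cvgB; first exact: cvg_cst.
  exact: cvg_mul_rho_sub2.
- exact: cvg_cst.
Unshelve. all: by end_near. Qed.

Lemma rho_sub2_ratio m : (1 <= m)%N ->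
  (2 - rho R m) / 2 ^- m = ((rho R m / 2) ^+ m)^-1.
Proof. by move=> m1; rewrite rho_sub2 // invrK expr_div_n invf_div mulrC. Qed.

(** The ratio equals [(rho_m / 2)^(-m)]. It is at least 1 since [rho_m < 2], and Bernoulli bounds
    [(rho_m / 2)^m] below by [1 - m (2 - rho_m) / 2], which tends to 1. *)
Lemma cvg_rho_sub2 : (2 - rho R m) / 2 ^- m @[m --> \oo] --> (1 : R).
Proof.
apply: (@squeeze_cvgr _ _ _ _ (cst 1)
  (fun m => (1 - m%:R * (2 - rho R m) / 2)^-1)).
- near=> m; have m1 : (1 <= m)%N by near: m; exact: nbhs_infty_ge.
  have r1 := rho_ge1 R m1; have r2 := rho_lt2 R m1.
  (* This keeps the Bernoulli bound positive, so that inverses can be compared. *)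
  have small : m%:R * (2 - rho R m) < 1.
    by near: m; apply: (cvgr_lt 0 cvg_mul_rho_sub2); exact: ltr01.
  have p0 : 0 < (rho R m / 2) ^+ m by rewrite exprn_gt0 // divr_gt0 //; lra.
  rewrite rho_sub2_ratio // invf_ge1 // exprn_ile1 /=; try lra.
  rewrite lef_pV2 ?posrE //; last by lra.
  have := @bernoulli_ineq (rho R m / 2 - 1) m.
  rewrite addrCA subrr addr0 => /(_ ltac:(lra)).
  by apply: le_trans; lra.
- exact: cvg_cst.
- rewrite -[X in _ --> X]invr1; apply: cvgV; first exact: oner_neq0.
  rewrite -[X in _ --> X](subr0 (1 : R)); apply: cvgB; first exact: cvg_cst.
  by rewrite -[X in _ --> X](mul0r (2^-1 : R)); apply: cvgMl; exact: cvg_mul_rho_sub2.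
Unshelve. all: by end_near. Qed.

Lemma ln_le_sub1 (x : R) : 0 < x -> ln x <= x - 1.
Proof. by move=> x0; rewrite -{1}(subrKC 1 x) le_ln1Dx //; lra. Qed.

(** Applying [ln x <= x - 1] at [rho_m / 2] and at [2 / rho_m] encloses [ln 2 - ln rho_m] between
    [(2 - rho_m) / 2] and [(2 - rho_m) / rho_m]. *)
Lemma cvg_ln_rho :
  (ln 2 - ln (rho R m)) / 2 ^- m.+1 @[m --> \oo] --> (1 : R).
Proof.
apply: (@squeeze_cvgr _ _ _ _ (fun m => (2 - rho R m) / 2 ^- m)
  (fun m => (2 - rho R m) / 2 ^- m * (2 / rho R m))).
- near=> m; have m1 : (1 <= m)%N by near: m; exact: nbhs_infty_ge.
  have r1 := rho_ge1 R m1; have r2 := rho_lt2 R m1.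
  have r0 : 0 < rho R m by lra.
  have p2 : 0 < (2 : R) ^+ m by rewrite exprn_gt0.
  rewrite !invrK exprS.
  have -> : (2 - rho R m) * 2 ^+ m = (2 - rho R m) / 2 * (2 * 2 ^+ m) by field.
  rewrite [X in _ <= _ <= X]mulrAC ler_pM2r ?mulr_gt0 //.
  rewrite ler_pM2r ?mulr_gt0 //; apply/andP; split.
    have := @ln_le_sub1 (rho R m / 2); rewrite ln_div ?posrE //.
    by move=> /(_ ltac:(lra)); lra.
  have := @ln_le_sub1 (2 / rho R m); rewrite ln_div ?posrE //.
  rewrite divr_gt0 // => /(_ isT)/le_trans; apply.
  by rewrite le_eqVlt; apply/orP; left; apply/eqP; field; rewrite gt_eqF.
- exact: cvg_rho_sub2.
- rewrite -[X in _ --> X](mul1r (1 : R)); apply: cvgM; first exact: cvg_rho_sub2.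
  have n2 : (2 : R) != 0 by [].
  rewrite -[X in _ --> X](divff n2).
  by apply: cvgMr; apply: cvgV => //; exact: cvg_rho.
Unshelve. all: by end_near. Qed.

End PerronAsymptotics.

(** * Minimal affine partitions and finite fibers *)

Section AffinePieces.
Variable R : realType.

(** Existence of some partition rules out the default value 0 of [xget], and well-ordering supplies
    the minimum. *)
Lemma affine_pieces_partition (f : R -> R) :
  (exists k, affine_partition f k) -> affine_partition f (affine_pieces f).
Proof.
move=> [k0 fk0].
have ex : exists k, `[< affine_partition f k >] by exists k0; apply/asboolP.
have [k /asboolP fk kmin] := ex_minnP ex.
have : exists k, [set k | affine_partition f k /\
    forall j, affine_partition f j -> (k <= j)%N] k.
  by exists k; split => // j fj; apply: kmin; apply/asboolP.
by move=> /(xgetPex 0%N)[].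
Qed.

(* The blocks are the fibers of the nondecreasing function
   x |-> #{s_i < x} + #{s_i <= x}: they are intervals, and such a fiber is
   either a singleton or free of points of s. *)
Lemma affine_partition_breakpoints (f : R -> R) (s : seq R) :
  (forall J : set R, is_interval J -> J `<=` `[0, 1] ->
     (forall x, J x -> x \notin s) -> affine_on J f) ->
  exists k, affine_partition f k.
Proof.
move=> fs.
pose L (x : R) := count (< x)%O s; pose M (x : R) := count (<= x)%O s.
pose g x := (L x + M x)%N.
have LM x : (L x <= M x)%N by apply: sub_count => u /ltW.
have ML x y : x < y -> (M x <= L y)%N.
  by move=> xy; apply: sub_count => u /= ux; exact: le_lt_trans xy.
have gle x y : x <= y -> (g x <= g y)%N.
  rewrite le_eqVlt => /orP[/eqP -> //|/ML]; rewrite /g.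
  by have := LM x; have := LM y; lia.
(* The chain [L x <= M x <= L y <= M y] and equal sums force all four counts to agree; [L x = M x]
   means that [x] is not in [s]. *)
have gfree x y : x < y -> g x = g y -> (x \notin s) && (y \notin s).
  move=> /ML xy; rewrite /g => gxy.
  rewrite -(count_lt_le_mem x) -(count_lt_le_mem y) -/(L _) -/(M _) -/(L y) -/(M y).
  by have := LM x; have := LM y; lia.
have gM x : (g x < (size s + size s).+1)%N by rewrite ltnS leq_add ?count_size.
pose J v := [set x | x \in `[0, 1]%R /\ g x = v].
(* Only attained values are kept, since the blocks of a partition must be nonempty. *)
pose V := [seq v <- iota 0 (size s + size s).+1 | `[< J v !=set0 >]].
exists (size V), (fun i : 'I_(size V) => J (nth 0%N V i)); split.
- split.
  + apply/seteqP; split => [x [i _ [x01 _]] //|x x01].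
    have xV : g x \in V.
      by rewrite mem_filter mem_iota leq0n add0n gM !andbT; apply/asboolP; exists x.
    have iV : (index (g x) V < size V)%N by rewrite index_mem.
    by exists (Ordinal iV) => //; split => //=; rewrite nth_index.
  + apply/trivIsetP => i j _ _ ij; apply/seteqP; split => // x [[_ gi] [_ gj]].
    case/eqP: ij; apply: val_inj; apply/eqP; 
    have uV : uniq V by rewrite filter_uniq ?iota_uniq.
    by rewrite -(nth_uniq 0%N (ltn_ord i) (ltn_ord j) uV) -gi gj.
  + move=> i _.
    have := mem_nth 0%N (ltn_ord i : (i < size V)%N).
    by rewrite mem_filter => /andP[/asboolP].
- move=> i x y [x01 gx] [y01 gy] z /andP[xz zy]; split.
    move: x01 y01; rewrite !in_itv /= => /andP[x0 _] /andP[_ y1].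
    by rewrite (le_trans x0) ?(le_trans zy).
  apply/eqP; rewrite eqn_leq -{1}gy -{1}gx.
  by rewrite !gle.
- move=> i; set v := nth _ _ _.
  have itvJ : is_interval (J v).
    move=> x y [x01 gx] [y01 gy] z /andP[xz zy]; split.
      move: x01 y01; rewrite !in_itv /= => /andP[x0 _] /andP[_ y1].
      by rewrite (le_trans x0) ?(le_trans zy).
    by apply/eqP; rewrite eqn_leq -{1}gy -{1}gx !gle.
  have [[u [Ju us]]|nos] := pselect (exists u, J v u /\ u \in s).
    exists 0, (f u) => x Jx; rewrite mul0r add0r; congr f.
    have [[_ gu] [_ gx]] := (Ju, Jx).
    have [xu|ux|//] := ltgtP x u.
      by have := gfree _ _ xu (etrans gx (esym gu)); rewrite us andbF.
    by have := gfree _ _ ux (etrans gu (esym gx)); rewrite us.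
  apply: fs => // [x []//|x Jx]; apply/negP => xs.
  by apply: nos; exists x.
Qed.

(** Equal values at two points of one block force slope 0, so the whole segment between them lies in
    the fiber. The list [s] witnesses finiteness of the fiber; [t] is the part being counted. *)
Lemma fiber_le_affine_partition (f : R -> R) (k : nat) (y : R) (s t : seq R) :
  affine_partition f k ->
  (forall x, 0 <= x <= 1 -> f x = y -> x \in s) ->
  uniq t -> (forall x, x \in t -> 0 <= x <= 1 /\ f x = y) ->
  (size t <= k)%N.
Proof.
move=> [I [[covI _ _] itvI affI]] fin ut ft.
have inj x x' i : x \in t -> x' \in t -> I i x -> I i x' -> ~ x < x'.
  move=> xt x't Ix Ix' xx'.
  have [[x01 fx] [x'01 fx']] := (ft x xt, ft x' x't).
  have [p [q fI]] := affI i.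
  have p0 : p = 0.
    have : p * (x' - x) = 0 by move: fx fx'; rewrite (fI x) // (fI x') //; lra.
    by move/eqP; rewrite mulf_eq0 subr_eq0 [x' == x]gt_eqF // orbF => /eqP.
  have fq : q = y by rewrite -fx fI // p0 mul0r add0r.
  (* These are infinitely many distinct points of the segment; [size s + 1] of them already overflow
     [s]. *)
  pose z (j : nat) := x + (x' - x) / j.+1%:R.
  have zs j : z j \in s.
    have j0 : 0 < j.+1%:R :> R by [].
    have zx : x <= z j by rewrite lerDl divr_ge0 // subr_ge0 ltW.
    have zx' : z j <= x'.
      by rewrite -lerBrDl ler_pdivrMr // ler_peMr ?ler1n // subr_ge0 ltW.
    apply: fin; first lra.
    by rewrite fI ?p0 ?mul0r ?add0r //; apply: itvI Ix Ix' _ _; rewrite zx.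
  have zinj : injective z.
    move=> j j' /addrI/mulfI; rewrite subr_eq0 gt_eqF // => /(_ isT)/invr_inj/eqP.
    by rewrite eqr_nat eqSS => /eqP.
  have : (size (map z (iota 0 (size s).+1)) <= size s)%N.
    apply: uniq_leq_size => [|_ /mapP[j _ ->]//].
    by rewrite map_inj_uniq ?iota_uniq.
  by rewrite size_map size_iota ltnn.
(* Sending a point to its block is injective on [t], which gives the pigeonhole bound. *)
pose blk x : option 'I_k := [pick i | `[< I i x >]].
have blkP x : x \in t -> exists2 i, blk x = Some i & I i x.
  move=> xt; rewrite /blk; case: pickP => [i /asboolP Ix|noi]; first by exists i.
  have [/andP[x0 x1] _] := ft x xt.
  have : `[0, 1]%classic x by rewrite /= in_itv /= x0.
  by rewrite -covI => -[i _ Ix]; move/asboolP: (noi i).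
have ub : uniq (map blk t).
  rewrite map_inj_in_uniq // => x x' xt x't bb.
  have [[i bi Ix] [i' bi' Ix']] := (blkP x xt, blkP x' x't).
  move: bb; rewrite bi bi' => -[ii']; subst i'.
  have [xx'|xx'|//] := ltgtP x x'; first by case: (inj x x' i).
  by case: (inj x' x i).
rewrite -(size_map blk) -[leqRHS](card_ord k) cardE -[leqRHS](size_map Some).
apply: uniq_leq_size => // _ /mapP[x xt ->].
by have [i -> _] := blkP x xt; rewrite map_f // mem_enum.
Qed.

End AffinePieces.

(** * Fibers and breakpoints of compositions of tent maps *)

Section TentCompositions.
Variable R : realType.
Implicit Types (w : R * R) (omega : nat -> R * R).

(** The part of [Ueps] free of [eps]: a peak of height at most 1 makes the tent preserve
    [[0, 1]]. *)
Definition layer w := [/\ 0 < w.1, 0 < w.2 & hpar w <= 1].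

(** With [mul2_cpar], this identifies [cpar w] as the turning point, where both branches reach the
    peak height [hpar w]. *)
Lemma mul1_cpar w : layer w -> w.1 * cpar w = hpar w.
Proof. by case=> a0 b0 _; rewrite /cpar mulrA. Qed.

Lemma mul2_cpar w : layer w -> w.2 * (1 - cpar w) = hpar w.
Proof. by case=> a0 b0 _; rewrite /cpar /hpar; field; rewrite gt_eqF ?addr_gt0. Qed.

Lemma cpar_itv w : layer w -> 0 < cpar w < 1.
Proof.
case=> a0 b0 _; rewrite /cpar divr_gt0 ?addr_gt0 //=.
by rewrite ltr_pdivrMr ?addr_gt0 // mul1r ltrDr.
Qed.

Lemma tent_left w x : layer w -> 0 <= x <= cpar w -> tent w x = w.1 * x.
Proof.
move=> lw /andP[x0 xc]; have [a0 b0 _] := lw.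
have := mul1_cpar lw; have := mul2_cpar lw => h2 h1.
rewrite /tent min_l; first by rewrite max_r // mulr_ge0 // ltW.
have : w.1 * x <= w.1 * cpar w by rewrite ler_pM2l.
have : w.2 * (1 - cpar w) <= w.2 * (1 - x) by rewrite ler_pM2l //; lra.
lra.
Qed.

Lemma tent_right w x : layer w -> cpar w <= x <= 1 -> tent w x = w.2 * (1 - x).
Proof.
move=> lw /andP[cx x1]; have [a0 b0 _] := lw.
have := mul1_cpar lw; have := mul2_cpar lw => h2 h1.
rewrite /tent min_r; first by rewrite max_r // mulr_ge0 ?subr_ge0 // ltW.
have : w.1 * cpar w <= w.1 * x by rewrite ler_pM2l.
have : w.2 * (1 - x) <= w.2 * (1 - cpar w) by rewrite ler_pM2l //; lra.
lra.
Qed.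

Lemma tent_itv w x : layer w -> 0 <= x <= 1 -> 0 <= tent w x <= 1.
Proof.
move=> lw /andP[x0 x1]; have [a0 b0 h1] := lw.
have [xc|/ltW cx] := leP x (cpar w).
- rewrite tent_left ?x0 // mulr_ge0 ?(ltW a0) //=.
  by rewrite (le_trans _ h1) // -mul1_cpar // ler_pM2l.
- rewrite tent_right ?cx // mulr_ge0 ?subr_ge0 ?(ltW b0) //=.
  by rewrite (le_trans _ h1) // -mul2_cpar // ler_pM2l // lerB.
Qed.

Lemma Fcomp_itv omega n x : (forall k, (k < n)%N -> layer (omega k)) ->
  0 <= x <= 1 -> 0 <= Fcomp omega n x <= 1.
Proof.
elim: n => [//|n IH] lw x01 /=; apply: tent_itv; first exact: lw.
by apply: IH => // k kn; apply/lw/ltnW.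
Qed.

(** Each branch of the last tent is injective, so the fiber over [y] is covered by the fibers of the
    shorter composition over [y / a] and [1 - y / b]. *)
Lemma Fcomp_fiber omega n y : (forall k, (k < n)%N -> layer (omega k)) ->
  exists s : seq R, forall x, 0 <= x <= 1 -> Fcomp omega n x = y -> x \in s.
Proof.
elim: n y => [|n IH] y lw.
  by exists [:: y] => x _ /= ->; rewrite inE.
have lw' k : (k < n)%N -> layer (omega k) by move=> kn; apply/lw/ltnW.
have lwn := lw n (ltnSn n); have [a0 b0 _] := lwn.
have [s1 s1P] := IH (y / (omega n).1) lw'.
have [s2 s2P] := IH (1 - y / (omega n).2) lw'.
exists (s1 ++ s2) => x x01 /= Fx; rewrite mem_cat.
have /andP[F0 F1] := Fcomp_itv lw' x01.
have [xc|/ltW cx] := leP (Fcomp omega n x) (cpar (omega n)).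
- rewrite s1P // -Fx tent_left ?F0 //; by field; rewrite gt_eqF.
- rewrite s2P ?orbT // -Fx tent_right ?cx //.
  by field; rewrite gt_eqF.
Qed.

(* A new break of T o F can only occur at a point of the fiber of F over the
   turning point of T, by the intermediate value theorem. *)
Lemma Fcomp_breakpoints omega n : (forall k, (k < n)%N -> layer (omega k)) ->
  exists s : seq R, forall J : set R, is_interval J -> J `<=` `[0, 1] ->
    (forall x, J x -> x \notin s) -> affine_on J (Fcomp omega n).
Proof.
elim: n => [|n IH] lw.
  by exists [::] => J _ _ _; exists 1, 0 => x _ /=; rewrite mul1r addr0 //.
have lw' k : (k < n)%N -> layer (omega k) by move=> kn; apply/lw/ltnW.
have lwn := lw n (ltnSn n); set w := omega n in lwn *.
have [s1 s1P] := IH lw'.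
have [s2 s2P] := Fcomp_fiber (cpar w) lw'.
exists (s1 ++ s2) => J itvJ J01 Js.
have [] := s1P J itvJ J01.
  by move=> x /Js; rewrite mem_cat negb_or => /andP[].
move=> p [q FJ].
have JE x : J x -> 0 <= x <= 1 by move=> /J01; rewrite /= in_itv.
have FJ01 x : J x -> 0 <= Fcomp omega n x <= 1 by move=> Jx; apply: Fcomp_itv (JE x Jx).
have Fc x : J x -> Fcomp omega n x != cpar w.
  move=> Jx; apply/eqP => Fx.
  by have := Js x Jx; rewrite mem_cat (s2P x (JE x Jx) Fx) orbT.
(* An affine function taking values on both sides of [cpar w] would equal it at the explicit point
   [z] between [x] and [x']. Hence a single branch of the tent acts on all of [J]. *)
have side x x' : J x -> J x' -> Fcomp omega n x < cpar w -> Fcomp omega n x' < cpar w.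
  move=> Jx Jx'; rewrite (FJ x Jx) => Fx; rewrite ltNge; apply/negP.
  rewrite le_eqVlt eq_sym (negbTE (Fc x' Jx')) /= (FJ x' Jx') => Fx'.
  have p0 : p != 0 by apply: contraTneq Fx' => p0; move: Fx; rewrite p0; lra.
  pose z := (cpar w - q) / p.
  have pz : p * z = cpar w - q by rewrite /z mulrC divfK.
  have Jz : J z.
    have [p0'|p0'|] := ltgtP p 0; last by move/eqP; rewrite (negbTE p0).
    - apply: (itvJ x' x) => //; apply/andP; split.
        by rewrite -(ler_nM2l p0'); lra.
      by rewrite -(ler_nM2l p0'); lra.
    - apply: (itvJ x x') => //; apply/andP; split.
        by rewrite -(ler_pM2l p0'); lra.
      by rewrite -(ler_pM2l p0'); lra.
  by have := Fc z Jz; rewrite (FJ z Jz) pz subrK eqxx.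
have [[u [Ju uc]]|nou] := pselect (exists u, J u /\ Fcomp omega n u < cpar w).
- exists (w.1 * p), (w.1 * q) => x Jx /=.
  have /andP[F0 _] := FJ01 x Jx.
  rewrite tent_left //; first by rewrite (FJ x Jx); ring.
  by rewrite F0 ltW // (side u).
- exists (- (w.2 * p)), (w.2 * (1 - q)) => x Jx /=.
  have /andP[_ F1] := FJ01 x Jx.
  rewrite tent_right //; first by rewrite (FJ x Jx); ring.
  by rewrite F1 andbT leNgt; apply/negP => xc; apply: nou; exists x.
Qed.

Lemma fiber_le_affine_pieces omega n y (t : seq R) :
  (forall k, (k < n)%N -> layer (omega k)) ->
  uniq t -> (forall x, x \in t -> 0 <= x <= 1 /\ Fcomp omega n x = y) ->
  (size t <= affine_pieces (Fcomp omega n))%N.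
Proof.
move=> lw ut tP.
have [s sP] := Fcomp_fiber y lw.
apply: fiber_le_affine_partition sP ut tP.
apply: affine_pieces_partition.
by have [s' /affine_partition_breakpoints] := Fcomp_breakpoints lw.
Qed.

End TentCompositions.

(** * Level thresholds and growth of fibers under favorable layers *)

Section FavorableLayers.
Variables (R : realType) (eps : R).
Hypothesis eps01 : 0 < eps < 1.

Lemma Ueps_layer w : Ueps eps w -> layer w.
Proof. by case. Qed.

Lemma Ueps_bounds w : Ueps eps w ->
  (2 - eps <= w.1 <= Kpar eps) && (2 - eps <= w.2 <= Kpar eps).
Proof.
move=> [_ _]; rewrite !ler_distl /Kpar => /andP[-> ->] /andP[-> ->] _.
by [].
Qed.

(** The full tent makes the infimum in [delta] one over a nonempty set, and it also yields an upper
    bound for [delta]. *)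
Lemma Ueps22 : Ueps eps (2, 2).
Proof.
have e0 : 0 <= eps by have := eps01; lra.
by split => //=; rewrite ?subrr ?normr0 // /hpar /= ler_pdivrMr; lra.
Qed.

Let E := [set Num.min (cpar w) (1 - cpar w) | w in Ueps eps].

(** Preimages on the left branch thus stay below [1 - delta], and those on the right branch stay
    above [delta], the level 0 threshold. *)
Lemma delta_le w : Ueps eps w -> 2 * delta eps <= cpar w <= 1 - 2 * delta eps.
Proof.
move=> Uw.
have : inf E <= Num.min (cpar w) (1 - cpar w).
  apply: ge_inf; last by exists w.
  exists 0 => _ [v /Ueps_layer/cpar_itv/andP[c0 c1] <-].
  by rewrite le_min ltW //= subr_ge0 ltW.
by rewrite le_min /delta -/E => /andP[]; lra.
Qed.

Lemma delta_gt0 : 0 < delta eps.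
Proof.
have /andP[e0 e1] := eps01.
(* A uniform lower bound: [cpar w] and [1 - cpar w] are quotients with numerator at least [2 - eps]
   and denominator at most [2 * Kpar eps]. *)
have q0 : 0 < (2 - eps) / (2 * Kpar eps) by rewrite divr_gt0 // /Kpar; lra.
suff : (2 - eps) / (2 * Kpar eps) <= inf E by rewrite /delta -/E; lra.
apply: lb_le_inf; first by eexists; exists (2, 2); first exact: Ueps22.
move=> _ [w Uw <-].
have [a0 b0 _] := Ueps_layer Uw.
have /andP[/andP[a1 a2] /andP[b1 b2]] := Ueps_bounds Uw.
have -> : 1 - cpar w = w.1 / (w.1 + w.2) by rewrite /cpar; field; rewrite gt_eqF ?addr_gt0.
have K0 : 0 < 2 * Kpar eps by rewrite /Kpar; lra.
have ab0 : 0 < w.1 + w.2 by rewrite addr_gt0.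
have le z : 2 - eps <= z -> (2 - eps) / (2 * Kpar eps) <= z / (w.1 + w.2).
  move=> hz; apply: ler_pM => //; [by lra | by rewrite invr_ge0 ltW |].
  by rewrite lef_pV2 ?posrE //; lra.
by rewrite le_min !le.
Qed.

Lemma delta_le4V : delta eps <= 1 / 4.
Proof.
have /andP[dc _] := delta_le Ueps22.
have c2 : cpar (2, 2) = 1 / 2 :> R by rewrite /cpar /=; field.
by rewrite c2 in dc; lra.
Qed.

Lemma rpar0 : rpar eps 0 = delta eps.
Proof. by rewrite /rpar expr0 invr1 mulr1. Qed.

Lemma rparS i : rpar eps i.+1 * Kpar eps = rpar eps i.
Proof.
have K0 : Kpar eps != 0 by rewrite gt_eqF // /Kpar; have := eps01; lra.
by rewrite /rpar exprSr invfM mulrA divfK.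
Qed.

Lemma rpar_gt0 i : 0 < rpar eps i.
Proof.
rewrite /rpar divr_gt0 ?delta_gt0 // exprn_gt0 // /Kpar; have := eps01; lra.
Qed.

Lemma rpar_le i j : (i <= j)%N -> rpar eps j <= rpar eps i.
Proof.
elim: j => [|j IH]; first by rewrite leqn0 => /eqP ->.
rewrite leq_eqVlt => /orP[/eqP -> //|ij]; apply: le_trans (IH ij).
rewrite -(rparS j) ler_peMr ?ltW ?rpar_gt0 // /Kpar; have := eps01; lra.
Qed.

(* wgt m is the Perron eigenvector of the transition matrix
   i -> {0, i + 1}, i < m, normalized by wgt m 0 = 1. *)
Definition wgt m i : R := \sum_(j < m - i) rho R m ^- j.+1.

(** The eigenvector equation at level [i]: the 1 is the weight of level 0, and at [i = m - 1] the
    other weight is an empty sum. *)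
Lemma wgtE m i : (i < m)%N -> wgt m i * rho R m = 1 + wgt m i.+1.
Proof.
move=> im; have r1 := rho_ge1 R (leq_ltn_trans (leq0n i) im).
have r0 : rho R m != 0 by rewrite gt_eqF //; lra.
rewrite /wgt; have -> : (m - i = (m - i.+1).+1)%N by lia.
rewrite big_ord_recl mulrDl expr1 mulVf // mulr_suml; congr (_ + _).
by apply: eq_bigr => j _; rewrite lift0 exprSr invfM mulrVK // ?unitfE.
Qed.

(** This is the equation of [rho_m] divided by [rho_m^m], with the summation index reversed. *)
Lemma wgt0 m : (0 < m)%N -> wgt m 0 = 1.
Proof.
move=> m0; have [/andP[r1 _] rE] := rho_spec R m0.
have rm : rho R m ^+ m != 0 by rewrite expf_neq0 // gt_eqF //; lra.
apply: (mulIf rm); rewrite mul1r [RHS]rE /wgt subn0 mulr_suml (reindex_inj rev_ord_inj) /=.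
apply: eq_bigr => j _.
have -> : ((m - j.+1).+1 = m - j)%N by have := ltn_ord j; lia.
rewrite -[X in _ * _ ^+ X](subnKC (ltnW (ltn_ord j))) exprD mulrCA mulVf ?mulr1 //.
by rewrite expf_neq0 // gt_eqF //; lra.
Qed.

Lemma wgt_le1 m i : (0 < m)%N -> wgt m i <= 1.
Proof.
move=> m0; rewrite -(wgt0 m0) /wgt subn0.
have r1 := rho_ge1 R m0.
rewrite -(big_mkord xpredT (fun j => rho R m ^- j.+1)).
rewrite -(big_mkord xpredT (fun j => rho R m ^- j.+1)).
rewrite [leRHS](big_cat_nat _ (leq_subr i m)) //= lerDl sumr_ge0 // => j _.
by rewrite invr_ge0 exprn_ge0 //; lra.
Qed.

(** The induction peels off the last layer, with level and target point generalized, since the two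
    preimages of [y] sit at different levels. The case [n = 0] rests on the weights being at most
    1. *)
Lemma fiber_growth m omega n i y :
  (0 < m)%N -> (forall k, (k < n)%N -> favorable eps m (omega k)) ->
  (i <= m)%N -> rpar eps i < y < 1 - rpar eps m ->
  exists t : seq R, [/\ uniq t,
    forall x, x \in t -> 0 <= x <= 1 /\ Fcomp omega n x = y
    & wgt m i * rho R m ^+ n <= (size t)%:R].
Proof.
move=> m0; elim: n i y => [|n IH] i y fav im /andP[iy ym].
  exists [:: y]; split => //; last by rewrite expr0 mulr1 wgt_le1.
  move=> x; rewrite inE => /eqP ->.
  by have := rpar_gt0 i; have := rpar_gt0 m; split => //; lra.
(* Level [m] has weight 0, so the empty list suffices there; below it, level [i + 1] stays in
   range. *)
have [mi|{}im] := leqP m i.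
  by exists [::]; split => //; rewrite /wgt (eqP mi) big_ord0 mul0r.
have fav' k : (k < n)%N -> favorable eps m (omega k) by move=> kn; apply/fav/ltnW.
have [Uw etaw] := fav n (ltnSn n).
set w := omega n in Uw etaw *.
have lw := Ueps_layer Uw; have [a0 b0 _] := lw.
have /andP[/andP[_ aK] /andP[_ bK]] := Ueps_bounds Uw.
have /andP[dc cd] := delta_le Uw.
have d0 := delta_gt0.
have rmd : rpar eps m <= delta eps by rewrite -rpar0 rpar_le.
have ri0 := rpar_gt0 i.+1.
have rmi : rpar eps m <= rpar eps i.+1 by exact: rpar_le.
have riE := rparS i.
(* Slopes are at most [Kpar eps], the ratio of consecutive thresholds, so division by a slope costs
   at most one level. *)
have riK z : z <= Kpar eps -> rpar eps i.+1 * z < y.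
  by move=> zK; apply: le_lt_trans iy; rewrite -riE ler_pM2l.
(* Favorability puts the peak at height at least [1 - rpar eps m], above [y], so both branches hit
   [y]. *)
have yh : y < hpar w by move: etaw; rewrite /Defs.eta; lra.
have y0 : 0 < y by have := rpar_gt0 i; lra.
have x1c : y / w.1 < cpar w by rewrite ltr_pdivrMr // mulrC mul1_cpar.
have x2c : y / w.2 < 1 - cpar w by rewrite ltr_pdivrMr // mulrC mul2_cpar.
have ix1 : rpar eps i.+1 < y / w.1 by rewrite ltr_pdivlMr // riK.
have ix2 : rpar eps i.+1 < y / w.2 by rewrite ltr_pdivlMr // riK.
have [t1 [ut1 t1P t1n]] : exists t : seq R, [/\ uniq t,
    forall x, x \in t -> 0 <= x <= 1 /\ Fcomp omega n x = y / w.1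
    & wgt m i.+1 * rho R m ^+ n <= (size t)%:R].
  by apply: IH => //; apply/andP; split => //; lra.
have [t2 [ut2 t2P t2n]] : exists t : seq R, [/\ uniq t,
    forall x, x \in t -> 0 <= x <= 1 /\ Fcomp omega n x = 1 - y / w.2
    & wgt m 0 * rho R m ^+ n <= (size t)%:R].
  by apply: IH => //; apply/andP; split; rewrite ?rpar0; lra.
exists (t1 ++ t2); split.
(* The lists are disjoint: [Fcomp omega n] takes values on opposite sides of the turning point on
   them. *)
- rewrite cat_uniq ut1 ut2 andbT /=; apply/hasPn => x /t2P[_ Fx2].
  by apply/negP => /t1P[_]; rewrite Fx2; lra.
- move=> x; rewrite mem_cat => /orP[/t1P|/t2P] [x01 Fx]; split => //=; rewrite Fx.
    rewrite tent_left //; last by apply/andP; split; lra.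
    by rewrite mulrC divfK // gt_eqF.
  rewrite tent_right //; last by apply/andP; split; lra.
  by field; rewrite gt_eqF.
- rewrite size_cat natrD exprS mulrA wgtE // mulrDl.
  by move: t2n; rewrite wgt0 //; lra.
Qed.

Lemma rho_le_affine_pieces m omega n :
  (0 < m)%N -> (forall k, (k < n)%N -> favorable eps m (omega k)) ->
  rho R m ^+ n <= (affine_pieces (Fcomp omega n))%:R.
Proof.
move=> m0 fav.
have d4 := delta_le4V; have rmd : rpar eps m <= delta eps by rewrite -rpar0 rpar_le.
(* The point 1/2 is admissible at level 0 because both thresholds are at most [delta eps <= 1/4]. *)
have [|t [ut tP tn]] := @fiber_growth m omega n 0 (1 / 2) m0 fav (leq0n m).
  by rewrite rpar0; lra.
move: tn; rewrite wgt0 // mul1r => /le_trans; apply; rewrite ler_nat.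
by apply: fiber_le_affine_pieces ut tP => k /fav[/Ueps_layer].
Qed.

End FavorableLayers.

Theorem theorem2p4 (R : realType) :
  (rho R 1 = 1 /\ (forall m : nat, (2 <= m)%N -> 1 < rho R m < 2)) /\
  (forall m : nat, (1 <= m)%N -> 2 - rho R m = rho R m ^- m) /\
  ((forall m m' : nat, (1 <= m)%N -> (m < m')%N -> rho R m < rho R m') /\
   rho R m @[m --> \oo] --> (2 : R)) /\
  ((2 - rho R m) / 2 ^- m @[m --> \oo] --> (1 : R)) /\
  ((ln 2 - ln (rho R m)) / 2 ^- m.+1 @[m --> \oo] --> (1 : R)) /\
  (forall m : nat, (1 <= m)%N ->
   exists2 c : R, 0 < c &
   forall (eps : R), 0 < eps < 1 ->
   forall (mu : probability (R * R)%type R), mu (Ueps eps) = 1%E ->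
   forall (d : measure_display) (Omega : measurableType d)
          (P : probability Omega R) (omega : nat -> {RV P >-> (R * R)%type}),
   iid_with_law omega mu ->
   forall (t : Omega) (n : nat), (1 <= n)%N ->
   (forall k : nat, (k < n)%N -> favorable eps m (omega k t)) ->
   c * rho R m ^+ n <= (affine_pieces (Fcomp (fun k => omega k t) n))%:R).
Proof.
split.
  split; first exact: rho1.
  by move=> m m2; rewrite rho_gt1 // rho_lt2 // ltnW.
split; first exact: rho_sub2.
split; first by split; [exact: rho_lt | exact: cvg_rho].
split; first exact: cvg_rho_sub2.
split; first exact: cvg_ln_rho.
move=> m m1; exists 1 => // eps eps01 mu _ d Omega P omega _ t n _ fav.
by rewrite mul1r (rho_le_affine_pieces eps01 m1).
Qed.
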